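(* For every $K\in\mathcal{K}_0^n$ we have $K^{\clubsuit}=\bigcup_{x\in K}B_x$ and $K'=\bigcap_{x\in K}P_x$.
   Context: A convex body in $\mathbb{R}^n$ is a closed convex set $K\subseteq\mathbb{R}^n$ with $0\in K$ (not assumed compact, nor with non-empty interior); $\mathcal{K}_0^n$ is the set of all convex bodies. The support function of $K$ is $h_K:S^{n-1}\to[0,\infty]$, $h_K(\theta)=\sup_{x\in K}\langle x,\theta\rangle$. A star set is a non-empty $A\subseteq\mathbb{R}^n$ such that $x\in A$ and $0\le\lambda\le1$ imply $\lambda x\in A$; its radial function is $r_A:S^{n-1}\to[0,\infty]$, $r_A(\theta)=\sup\{\lambda\ge0:\lambda\theta\in A\}$. A star body is a star set $A$ with $r_A(\theta)\theta\in A$ for all $\theta\in S^{n-1}$ with $r_A(\theta)<\infty$; it is uniquely determined by $r_A$. For $K\in\mathcal{K}_0^n$, the flower $K^{\clubsuit}$ is the star body with radial function $r_{K^{\clubsuit}}=h_K$. For $g:S^{n-1}\to[0,\infty]$, $A[g]=\{x\in\mathbb{R}^n:\langle x,\theta\rangle\le g(\theta)\text{ for all }\theta\in S^{n-1}\}$. The reciprocal body of $K$ is $K'=A[1/h_K]$, with $1/0=\infty$, $1/\infty=0$. For $x\in\mathbb{R}^n$, $B_x=B\left(\frac{x}{2},\frac{|x|}{2}\right)$ is the closed Euclidean ball with center $\frac{x}{2}$ and radius $\frac{|x|}{2}$, and $P_x$ is the paraboloid $P_x=\left\{y\in\mathbb{R}^n:\ \langle y,x\rangle\le1-\frac14|x|^2\left|\operatorname{Proj}_{x^\perp}y\right|^2\right\}$,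 where $\operatorname{Proj}_{x^\perp}$ is the orthogonal projection to the hyperplane orthogonal to $x$ (so $P_0=\mathbb{R}^n$).
   Formalization: The first identity is proved for every K as equality of radial functions (K♣ is the star body with the radial function of the union), and as equality of sets only when h_K(θ) is attained at each θ where it is finite; otherwise the set equality fails. *)

(* Defs.v *)
(* MathComp-Analysis; R^n is 'rV[R]_n, whose canonical topology is the usual
   one. *)
From mathcomp Require Import all_boot all_order all_algebra.
From mathcomp Require Import all_classical all_reals all_analysis.
Set Implicit Arguments.
Unset Strict Implicit.
Unset Printing Implicit Defensive.
Import Order.TTheory GRing.Theory Num.Theory numFieldNormedType.Exports.
Local Open Scope classical_set_scope.
Local Open Scope ring_scope.

Section euclidean.
Context {R : realType} {n : nat}.
Implicit Types x y theta : 'rV[R]_n.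

Definition dotv x y : R := \sum_(i < n) x 0 i * y 0 i.

(* The library's norm `|x| on 'rV[R]_n is the sup norm, hence this one. *)
Definition enorm x : R := Num.sqrt (dotv x x).

Definition usphere : set 'rV[R]_n := [set theta | enorm theta = 1].

(* For x = 0 the quotient is 0 by the convention 0^-1 = 0, so this is the
   identity, the projection onto 0^\perp = R^n. *)
Definition proj_perp x y : 'rV[R]_n := y - (dotv y x / dotv x x) *: x.

(* B(x/2, |x|/2) *)
Definition diam_ball x : set 'rV[R]_n :=
  [set y | enorm (y - 2^-1 *: x) <= enorm x / 2].

Definition paraboloid x : set 'rV[R]_n :=
  [set y | dotv y x <= 1 - 4^-1 * enorm x ^+ 2 * enorm (proj_perp x y) ^+ 2].

End euclidean.

(* Functions on the unit sphere are represented by functions on the whole space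
   of which only the values on [usphere] are ever used. *)
Section bodies.
Context {R : realType} {n : nat}.
Implicit Types (K A : set 'rV[R]_n) (g : 'rV[R]_n -> \bar R).

Definition convex_body K : Prop := [/\ closed K, convex_set K & K 0].

Definition supportf K (theta : 'rV[R]_n) : \bar R :=
  ereal_sup [set (dotv x theta)%:E | x in K].

Definition star_set A : Prop :=
  A !=set0 /\ forall x (l : R), A x -> 0 <= l <= 1 -> A (l *: x).

Definition radial A (theta : 'rV[R]_n) : \bar R :=
  ereal_sup [set l%:E | l in [set l : R | 0 <= l /\ A (l *: theta)]].

Definition star_body A : Prop :=
  star_set A /\ forall theta, usphere theta -> (radial A theta < +oo)%E ->
                  A (fine (radial A theta) *: theta).

(* The star body with radial function g, for g >= 0 on the sphere; see
   [star_body_ofP] and [star_body_of_radial] below. *)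
Definition star_body_of g : set 'rV[R]_n :=
  [set x | x != 0 -> ((enorm x)%:E <= g ((enorm x)^-1 *: x))%E].

Definition flower K : set 'rV[R]_n := star_body_of (supportf K).

(* A[g] *)
Definition wulff g : set 'rV[R]_n :=
  [set x | forall theta, usphere theta -> ((dotv x theta)%:E <= g theta)%E].

(* The inverse of \bar R satisfies 0^-1 = +oo and +oo^-1 = 0. *)
Definition reciprocal K : set 'rV[R]_n :=
  wulff (fun theta => ((supportf K theta)^-1)%E).

End bodies.

Section facts.
Context {R : realType} {n : nat}.
Implicit Types (K A : set 'rV[R]_n) (g : 'rV[R]_n -> \bar R).
Implicit Types x y theta : 'rV[R]_n.

Lemma dotv_ge0 x : 0 <= dotv x x.
Proof. by apply: sumr_ge0 => i _; rewrite -expr2 sqr_ge0. Qed.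

Lemma enorm_ge0 x : 0 <= enorm x. Proof. exact: sqrtr_ge0. Qed.

Lemma enorm_eq0 x : (enorm x == 0) = (x == 0).
Proof.
rewrite sqrtr_eq0 le_eqVlt ltNge dotv_ge0 orbF /dotv psumr_eq0; last first.
  by move=> i _; rewrite -expr2 sqr_ge0.
apply/allP/eqP => [h|-> i _]; last by rewrite !mxE mul0r eqxx implybT.
apply/rowP => i; rewrite mxE.
by have := h i (mem_index_enum i); rewrite /= -expr2 sqrf_eq0 => /eqP.
Qed.

Lemma enormZ (l : R) x : enorm (l *: x) = `|l| * enorm x.
Proof.
rewrite /enorm; have -> : dotv (l *: x) (l *: x) = l ^+ 2 * dotv x x.
  rewrite /dotv mulr_sumr; apply: eq_bigr => i _.
  by rewrite !mxE mulrACA expr2.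
by rewrite sqrtrM ?sqr_ge0// sqrtr_sqr.
Qed.

Lemma usphere_neq0 theta : usphere theta -> theta != 0.
Proof. by rewrite /usphere /= -enorm_eq0 => ->; rewrite oner_eq0. Qed.

Lemma usphere_normalize x : x != 0 -> usphere ((enorm x)^-1 *: x).
Proof.
move=> x0; rewrite /usphere /= enormZ ger0_norm ?invr_ge0 ?enorm_ge0//.
by rewrite mulVf// enorm_eq0.
Qed.

Lemma supportf_ge0 K theta : K 0 -> (0 <= supportf K theta)%E.
Proof.
move=> K0; apply: ereal_sup_ubound; exists 0 => //.
by rewrite /dotv big1// => i _; rewrite mxE mul0r.
Qed.

Lemma star_body_ofP g : (forall theta, usphere theta -> (0 <= g theta)%E) ->
  star_body (star_body_of g) /\
  forall theta, usphere theta -> radial (star_body_of g) theta = g theta.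
Proof.
move=> g0.
have ray theta (l : R) : usphere theta -> 0 <= l ->
    star_body_of g (l *: theta) <-> (l%:E <= g theta)%E.
  move=> S; rewrite le_eqVlt => /orP[/eqP <-|l0].
    by split => [_|_]; [exact: g0 | rewrite scale0r /star_body_of /= eqxx].
  rewrite /star_body_of /= scaler_eq0 (negPf (usphere_neq0 S)) gt_eqF//=.
  rewrite enormZ S gtr0_norm// mulr1 scalerA mulVf ?gt_eqF// scale1r.
  by split => [/(_ isT)|].
have rad theta : usphere theta -> radial (star_body_of g) theta = g theta.
  move=> S; apply/eqP; rewrite eq_le; apply/andP; split.
    by apply: ge_ereal_sup => _ [l [l0 /(ray _ _ S l0) ?] <-].
  have := g0 _ S; case gS : (g theta) => [r| |]//.
    rewrite lee_fin => r0; apply: ereal_sup_ubound; exists r => //.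
    by split => //; apply/(ray _ _ S r0); rewrite gS.
  move=> _; rewrite leye_eq; apply/eqP/eqyP => r r0.
  apply: ereal_sup_ubound; exists r => //; split; first exact: ltW.
  by apply/(ray _ _ S (ltW r0)); rewrite gS leey.
split=> //; split; first split.
- by exists 0; rewrite /star_body_of /= eqxx.
- move=> x l Ax /andP[l0 l1].
  have [->|x0] := eqVneq x 0; first by rewrite scaler0 /star_body_of /= eqxx.
  have S := usphere_normalize x0.
  have -> : l *: x = (l * enorm x) *: ((enorm x)^-1 *: x).
    by rewrite scalerA mulfK// enorm_eq0.
  apply/ray => //; first by rewrite mulr_ge0// enorm_ge0.
  apply: (le_trans _ (Ax x0)); rewrite lee_fin.
  by rewrite ler_piMl// enorm_ge0.
move=> theta S; rewrite rad//; have := g0 _ S; case gS : (g theta) => [r| |]//.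
by rewrite lee_fin => r0 _; apply/(ray _ _ S) => //=; rewrite gS.
Qed.

Lemma star_body_of_radial A : star_body A -> A = star_body_of (radial A).
Proof.
move=> [[[a Aa] starA] endA].
have A0 : A 0 by rewrite -(scale0r a); apply: starA => //; rewrite lexx ler01.
apply/seteqP; split => x.
  move=> Ax x0; apply: ereal_sup_ubound; exists (enorm x) => //.
  split; first exact: enorm_ge0.
  by rewrite scalerA divff ?scale1r// enorm_eq0.
have [->//|x0 /(_ x0)] := eqVneq x 0.
set t := (enorm x)^-1 *: x => xt; have S : usphere t := usphere_normalize x0.
have N0 : 0 < enorm x by rewrite lt_neqAle enorm_ge0 eq_sym enorm_eq0 x0.
have xE : x = enorm x *: t by rewrite scalerA divff ?scale1r// gt_eqF.
suff [r [xr Ar]] : exists r, enorm x <= r /\ A (r *: t).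
  have r0 : 0 < r := lt_le_trans N0 xr.
  rewrite xE -[enorm x](divfK (lt0r_neq0 r0)) -scalerA; apply: starA => //.
  by rewrite divr_ge0 ?(ltW N0) ?(ltW r0)//= ler_pdivrMr// mul1r.
case: (ltP (radial A t) +oo%E) => [rfin|].
  exists (fine (radial A t)); split; last exact: endA.
  rewrite -lee_fin fineK// fin_numElt rfin andbT.
  by apply: lt_le_trans xt; exact: ltNyr.
rewrite leye_eq => /eqP rinf.
have : ((enorm x)%:E < radial A t)%E by rewrite rinf ltry.
move=> /ereal_sup_gt[_ [r [_ Ar] <-]]; rewrite lte_fin => /ltW xr.
by exists r.
Qed.

End facts.

(* Main.v *)
Require Import Defs.
From mathcomp Require Import all_boot all_order all_algebra.
From mathcomp Require Import all_classical all_reals all_analysis.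
From mathcomp Require Import ring lra.
Set Implicit Arguments.
Unset Strict Implicit.
Unset Printing Implicit Defensive.
Import Order.TTheory GRing.Theory Num.Theory.
Local Open Scope classical_set_scope.
Local Open Scope ring_scope.

(** Both identities reduce to a description of [diam_ball x] and [paraboloid x]
by scalar products, in which [x] occurs linearly, so that the supremum over
[x] in [K] turns into the support function.

By Thales, [y] lies in the ball with diameter from [0] to [x] iff
<y, y> <= <x, y> ([diam_ballE]).  Hence the ray in direction [theta] meets the
union of the balls in the length 0 and the lengths l > 0 with l <= <x, theta>
for some [x] in [K].  As [0] is in [K], the supremum of these is h_K(theta):
this is [radial_bigcup_diam_ball].  When h_K(theta) is attained or infinite, the
union also contains every point of length at most h_K(theta) on that ray.

For the paraboloids, Pythagoras replaces |x|^2 |Proj y|^2 by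
|x|^2 |y|^2 - <x, y>^2, and completing the square turns the defining inequality
into |x| |y| + <x, y> <= 2 ([paraboloidE]).  Now (|x| |y| + <x, y>) / 2 bounds
<x, theta> <y, theta> over unit vectors [theta], as reflecting [y] in the line
of [theta] shows, and the bisector of the directions of [x] and [y] attains the
bound.  A bisector is missing only when the bound is 0, hence below 1 anyway.
So [y] is in [paraboloid x] iff <x, theta> <y, theta> <= 1 for all [theta]
([paraboloidP]).  Requiring this for all [x] in [K] says that <y, theta> <= 1 / h_K(theta) for all [theta], where
replacing [theta] by its opposite takes care of negative factors. *)

(** * The Euclidean scalar product *)

Section euclidean_theory.
Context {R : realType} {n : nat}.
Implicit Types (x y z theta : 'rV[R]_n) (c : R).

Lemma dotvC x y : dotv x y = dotv y x.
Proof. by apply: eq_bigr => i _; rewrite mulrC. Qed.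

Lemma dotvDl x y z : dotv (x + y) z = dotv x z + dotv y z.
Proof. by rewrite -big_split; apply: eq_bigr => i _; rewrite mxE mulrDl. Qed.

Lemma dotvZl c x y : dotv (c *: x) y = c * dotv x y.
Proof. by rewrite mulr_sumr; apply: eq_bigr => i _; rewrite mxE mulrA. Qed.

Lemma dotvNl x y : dotv (- x) y = - dotv x y.
Proof. by rewrite -scaleN1r dotvZl mulN1r. Qed.

Lemma dotvDr x y z : dotv x (y + z) = dotv x y + dotv x z.
Proof. by rewrite dotvC dotvDl !(dotvC x). Qed.

Lemma dotvZr c x y : dotv x (c *: y) = c * dotv x y.
Proof. by rewrite dotvC dotvZl dotvC. Qed.

Lemma dotvNr x y : dotv x (- y) = - dotv x y.
Proof. by rewrite dotvC dotvNl dotvC. Qed.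

Definition dotvE := (dotvDl, dotvDr, dotvNl, dotvNr, dotvZl, dotvZr).

Lemma dot0v x : dotv 0 x = 0.
Proof. by rewrite -(scale0r 0) dotvZl mul0r. Qed.

Lemma sqr_enorm x : enorm x ^+ 2 = dotv x x.
Proof. by rewrite sqr_sqrtr// dotv_ge0. Qed.

Lemma enorm0 : enorm (0 : 'rV[R]_n) = 0.
Proof. by apply/eqP; rewrite enorm_eq0. Qed.

Lemma enorm_gt0 x : (0 < enorm x) = (x != 0).
Proof. by rewrite lt0r enorm_ge0 andbT enorm_eq0. Qed.

(** For nonzero [x] and [y], this is the nonnegativity of the squared length of
[enorm y *: x + enorm x *: y]. *)
Lemma dotv_ge_Nenorm x y : 0 <= enorm x * enorm y + dotv x y.
Proof.
have [->|x0] := eqVneq x 0; first by rewrite enorm0 dot0v mul0r addr0.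
have [->|y0] := eqVneq y 0; first by rewrite enorm0 dotvC dot0v mulr0 addr0.
have xy0 : 0 < enorm x * enorm y by rewrite mulr_gt0// enorm_gt0.
rewrite -(pmulr_rge0 _ xy0) -(pmulr_rge0 _ (ltr0n R 2)).
have := dotv_ge0 (enorm y *: x + enorm x *: y).
rewrite !dotvE -!sqr_enorm (dotvC y x); congr (0 <= _); ring.
Qed.

Lemma dotv_le_enorm x y : dotv x y <= enorm x * enorm y.
Proof.
have := dotv_ge_Nenorm x (- y).
by rewrite dotvNr -scaleN1r enormZ normrN1 mul1r subr_ge0.
Qed.

Lemma usphereN theta : usphere theta -> usphere (- theta).
Proof. by rewrite /usphere /= -scaleN1r enormZ normrN1 mul1r. Qed.

(** * Balls and paraboloids through scalar products *)

(** Thales: when [y] is neither [0] nor [x], the right-hand side says that the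
angle at [y] in the triangle [0], [y], [x] is not acute. *)
Lemma diam_ballE x y : diam_ball x y <-> dotv y y <= dotv x y.
Proof.
rewrite /diam_ball /= -ler_sqr ?nnegrE ?enorm_ge0//; last first.
  by rewrite divr_ge0// enorm_ge0.
rewrite exprMn !sqr_enorm !dotvE (dotvC y x); split; lra.
Qed.

Lemma sqr_enorm_proj_perp x y :
  enorm x ^+ 2 * enorm (proj_perp x y) ^+ 2 =
  (enorm x * enorm y) ^+ 2 - dotv x y ^+ 2.
Proof.
have [->|x0] := eqVneq x 0.
  by rewrite enorm0 dot0v !mul0r expr0n/= mul0r subr0.
have xx0 : dotv x x != 0 by rewrite -sqr_enorm sqrf_eq0 enorm_eq0.
by rewrite exprMn !sqr_enorm /proj_perp !dotvE (dotvC y x); field.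
Qed.

Lemma paraboloidE x y :
  paraboloid x y <-> enorm x * enorm y + dotv x y <= 2.
Proof.
rewrite /paraboloid /= -mulrA sqr_enorm_proj_perp dotvC.
have := dotv_le_enorm x y; have : 0 <= enorm x * enorm y.
  by rewrite mulr_ge0// enorm_ge0.
move: (dotv x y) (enorm x * enorm y) => a m m0 am.
(* Both sides say [m ^+ 2 <= (2 - a) ^+ 2], since [a <= 2] on either side. *)
split => h; last by nra.
have a1 : a <= 1 by nra.
by rewrite -lerBrDr -ler_sqr ?nnegrE; nra.
Qed.

(** The reflection [2 * dotv y theta *: theta - y] of [y] has the length of
[y], so its scalar product with [x] is at most [enorm x * enorm y]. *)
Lemma dotv_usphere_le x y theta : usphere theta ->
  dotv x theta * dotv y theta <= (enorm x * enorm y + dotv x y) / 2.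
Proof.
move=> S; have tt : dotv theta theta = 1 by rewrite -sqr_enorm S expr1n.
set z := 2 * dotv y theta *: theta - y.
have zy : enorm z = enorm y.
  rewrite /enorm; congr Num.sqrt.
  by rewrite /z !dotvE tt (dotvC theta y); ring.
have := dotv_le_enorm x z; rewrite zy /z !dotvE; lra.
Qed.

(** Equality in [dotv_usphere_le] holds at the bisector of the directions of
[x] and [y], and the hypothesis keeps these from being opposite. *)
Lemma dotv_usphere_eq x y : 0 < enorm x * enorm y + dotv x y ->
  exists2 theta, usphere theta &
    dotv x theta * dotv y theta = (enorm x * enorm y + dotv x y) / 2.
Proof.
have [->|x0] := eqVneq x 0; first by rewrite enorm0 dot0v mul0r addr0 ltxx.
have [->|y0] := eqVneq y 0.
  by rewrite enorm0 dotvC dot0v mulr0 addr0 ltxx.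
move=> xy0; set w := enorm y *: x + enorm x *: y.
have nx : 0 < enorm x by rewrite enorm_gt0.
have ny : 0 < enorm y by rewrite enorm_gt0.
have ww : dotv w w =
    2 * (enorm x * enorm y) * (enorm x * enorm y + dotv x y).
  by rewrite /w !dotvE -!sqr_enorm (dotvC y x); ring.
have w0 : w != 0.
  by rewrite -enorm_gt0 sqrtr_gt0 ww !mulr_gt0.
exists ((enorm w)^-1 *: w); first exact: usphere_normalize.
rewrite !dotvZr mulrACA -expr2 exprVn sqr_enorm ww /w !dotvE -!sqr_enorm.
rewrite (dotvC y x); field.
by rewrite !gt_eqF.
Qed.

Lemma paraboloidP x y : paraboloid x y <->
  forall theta, usphere theta -> dotv x theta * dotv y theta <= 1.
Proof.
rewrite paraboloidE; split => [h theta S|h].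
  by apply: (le_trans (dotv_usphere_le x y S)); lra.
have [|xy0] := leP (enorm x * enorm y + dotv x y) 0; first by lra.
by have [theta S] := dotv_usphere_eq xy0; have := h _ S; lra.
Qed.

End euclidean_theory.

(** * Support functions, flowers and reciprocal bodies *)

Lemma le_EFin_inve {R : realType} (r : R) (h : \bar R) : 0 < r ->
  (0 <= h)%E -> (r%:E <= h^-1)%E = (h <= (r^-1)%:E)%E.
Proof.
move=> r0; case: (inveP h) => [_|_|//|s s0].
- by rewrite leey lee_fin invr_ge0 ltW.
- by rewrite lee_fin leNgt r0.
- rewrite !lee_fin => s_ge0; have s_gt0 : 0 < s by rewrite lt0r s0.
  by rewrite -[r in LHS]invrK lef_pV2 ?posrE ?invr_gt0.
Qed.

Section support.
Context {R : realType} {n : nat}.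
Implicit Types (K : set 'rV[R]_n) (x y theta : 'rV[R]_n) (l : R).

Lemma le_supportf K theta x : K x -> ((dotv x theta)%:E <= supportf K theta)%E.
Proof. by move=> Kx; apply: ereal_sup_ubound; exists x. Qed.

Lemma supportf_le K theta (h : \bar R) :
  (supportf K theta <= h)%E <-> forall x, K x -> ((dotv x theta)%:E <= h)%E.
Proof.
split => [Kh x Kx|Kh]; first exact: le_trans (le_supportf _ Kx) Kh.
by apply: ge_ereal_sup => _ [x Kx <-]; exact: Kh.
Qed.

Lemma eq_star_body_of (g1 g2 : 'rV[R]_n -> \bar R) :
  (forall theta, usphere theta -> g1 theta = g2 theta) ->
  star_body_of g1 = star_body_of g2.
Proof.
move=> g12; apply/seteqP; split => x gx x0; have := gx x0;
  by rewrite g12//; exact: usphere_normalize.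
Qed.

Lemma diam_ball_ray x theta l : usphere theta -> 0 < l ->
  diam_ball x (l *: theta) <-> l <= dotv x theta.
Proof.
move=> S l0; rewrite diam_ballE dotvZr dotvZl dotvZr -sqr_enorm S expr1n mulr1.
by rewrite ler_pM2l.
Qed.

Lemma radial_bigcup_diam_ball K theta : K 0 -> usphere theta ->
  radial (\bigcup_(x in K) diam_ball x) theta = supportf K theta.
Proof.
move=> K0 S; apply/eqP; rewrite eq_le; apply/andP; split.
  apply: ge_ereal_sup => _ [l [l_ge0 [x Kx xl]] <-].
  have [<-|l0] := eqVneq 0 l; first exact: supportf_ge0.
  have {}l0 : 0 < l by rewrite lt0r eq_sym l0.
  by apply: le_trans (le_supportf _ Kx); rewrite lee_fin -diam_ball_ray.
apply/supportf_le => x Kx; have [xt|xt] := leP (dotv x theta) 0.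
  apply: (@le_trans _ _ 0%:E); first by rewrite lee_fin.
  apply: ereal_sup_ubound; exists 0 => //; split => //; exists 0 => //.
  by rewrite scale0r diam_ballE.
apply: ereal_sup_ubound; exists (dotv x theta) => //; split; first exact: ltW.
by exists x => //; rewrite diam_ball_ray.
Qed.

Lemma flower_radial K : K 0 ->
  flower K = star_body_of (radial (\bigcup_(x in K) diam_ball x)).
Proof.
by move=> K0; apply: eq_star_body_of => theta S; rewrite radial_bigcup_diam_ball.
Qed.

Lemma flower_bigcup K : K 0 ->
  (forall theta, usphere theta -> (supportf K theta < +oo)%E ->
     exists2 x, K x & (dotv x theta)%:E = supportf K theta) ->
  flower K = \bigcup_(x in K) diam_ball x.
Proof.
move=> K0 attained; apply/seteqP; split => y.
  have [->|y0 /(_ y0)] := eqVneq y 0.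
    by exists 0 => //; rewrite diam_ballE.
  set theta := (enorm y)^-1 *: y; have S : usphere theta.
    exact: usphere_normalize.
  have ny : 0 < enorm y by rewrite enorm_gt0.
  move=> yK; suff [x Kx yx] : exists2 x, K x & enorm y <= dotv x theta.
    exists x => //; have -> : y = enorm y *: theta.
      by rewrite scalerA divff ?scale1r// gt_eqF.
    by rewrite diam_ball_ray.
  have [/(attained _ S)[x Kx xK]|] := ltP (supportf K theta) +oo%E.
    by exists x => //; rewrite -lee_fin xK.
  rewrite leye_eq => /eqP Koo.
  have : ((enorm y)%:E < supportf K theta)%E by rewrite Koo ltry.
  by move=> /ereal_sup_gt[_ [x Kx <-]] /ltW yx; exists x.
case=> x Kx xy y0; have S := usphere_normalize y0.
apply: le_trans (le_supportf _ Kx); rewrite lee_fin -diam_ball_ray ?enorm_gt0//.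
by rewrite scalerA divff ?scale1r// enorm_eq0.
Qed.

Lemma reciprocal_bigcap K : K 0 ->
  reciprocal K = \bigcap_(x in K) paraboloid x.
Proof.
move=> K0; have hK theta := supportf_ge0 theta K0.
apply/seteqP; split => y.
  move=> Ky x Kx; apply/paraboloidP.
  have pos theta : usphere theta -> 0 < dotv y theta ->
      dotv x theta * dotv y theta <= 1.
    move=> S yt; rewrite -ler_pdivlMr// div1r -lee_fin.
    apply: (le_trans (le_supportf _ Kx)).
    by rewrite -le_EFin_inve//; exact: Ky.
  move=> theta S; have [yt|yt|yt] := ltgtP (dotv y theta) 0.
  - rewrite -mulrNN -!dotvNr; apply: pos; first exact: usphereN.
    by rewrite dotvNr oppr_gt0.
  - exact: pos.
  - by rewrite yt mulr0 ler01.
move=> Py theta S; have [yt|yt] := leP (dotv y theta) 0.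
  by apply: (@le_trans _ _ 0%:E); rewrite ?lee_fin// inve_ge0.
rewrite le_EFin_inve//; apply/supportf_le => x Kx.
rewrite lee_fin -div1r ler_pdivlMr//.
by move/paraboloidP: (Py x Kx); apply.
Qed.

End support.

Theorem proposition19 (R : realType) (n : nat) (K : set 'rV[R]_n)
    (convexK : convex_body K) :
  [/\ flower K = star_body_of (radial (\bigcup_(x in K) diam_ball x)),
      (forall theta, usphere theta -> (supportf K theta < +oo)%E ->
         exists2 x, K x & (dotv x theta)%:E = supportf K theta) ->
      flower K = \bigcup_(x in K) diam_ball x
    & reciprocal K = \bigcap_(x in K) paraboloid x].
Proof.
case: convexK => _ _ K0; split; first exact: flower_radial.
  exact: flower_bigcup.
exact: reciprocal_bigcap.
Qed.
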